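(* Let $(X,c)$ be a nondegenerate cyclic poset with covering poset $\pi:\widetilde X\to X$ and defining automorphism $\sigma:\widetilde X\to\widetilde X$. (a) Then $\widetilde X$ is a $\mathbb Z$-poset with the action of $\mathbb Z$ given by $n\cdot\tilde x:=\sigma^n\tilde x$ for $n\in\mathbb Z$. (b) The mapping which sends $x\in X$ to $\pi^{-1}(x)\subseteq\widetilde X$ is a bijection between $X$ and the set of cyclic $\mathbb Z$-subposets of $\widetilde X$.
   Context: A cyclic poset is a pair $(X,c)$ where $X$ is a set and $c:X^3\to\mathbb N$ satisfies $c(x,y,z)-c(w,y,z)+c(w,x,z)-c(w,x,y)=0$ for all $w,x,y,z$ and $c(x,x,y)=0=c(x,y,y)$. It is nondegenerate if $c(x,y,x)\neq0$ for all $x\ne y$. Here ''poset'' means a set with a reflexive, transitive relation $\le$ (antisymmetry not assumed); $x<y$ means $x\le y$ and $y\not\le x$. A covering poset of a set $X$ is a poset $\widetilde X$ with a map $\pi:\widetilde X\to X$ such that: (1) for every $x\in X$, $\pi^{-1}(x)\cong\mathbb Z$ as posets; (2) the map $\sigma:\widetilde X\to\widetilde X$ sending $\tilde x$ to the smallest element of $\pi^{-1}\pi(\tilde x)$ that is $>\tilde x$ is a poset automorphism of $\widetilde X$ (the defining automorphism); (3) for all $\tilde x,\tilde y\in\widetilde X$ there are $m,n\in\mathbb N$ with $\tilde x\le\sigma^m\tilde y\le\sigma^{m+n}\tilde x$. Covering posets of $X$ correspond bijectively to cyclic posets $(X,c)$ as follows: choose a section $\lambda:X\to\widetilde X$ of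 $\pi$, let $b(x,y)$ be the smallest $n\in\mathbb Z$ with $\lambda(x)\le\sigma^n\lambda(y)$, and put $c(x,y,z)=b(x,y)+b(y,z)-b(x,z)$. The covering poset of $(X,c)$ is the one corresponding to $(X,c)$. A $\mathbb Z$-poset is a set with a reflexive, antisymmetric and transitive relation together with an action of the ordered additive group $\mathbb Z$ that is order preserving in both variables. A $\mathbb Z$-poset is cyclic if it is generated by one element, i.e. equals $\mathbb Z\cdot a$ for some $a$. *)

(* Defs.v *)
From mathcomp Require Import all_boot all_order all_algebra.
From mathcomp Require Import classical_sets functions.

Set Implicit Arguments.
Unset Strict Implicit.
Unset Printing Implicit Defensive.

Import Order.TTheory GRing.Theory Num.Theory.
Local Open Scope classical_set_scope.
Local Open Scope ring_scope.

Record cyclic_poset (X : Type) (c : X -> X -> X -> nat) : Prop := {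
  cyclic_poset_cocycle : forall w x y z : X,
    (c x y z)%:Z - (c w y z)%:Z + (c w x z)%:Z - (c w x y)%:Z = 0;
  cyclic_poset_reduced : forall x y : X, c x x y = 0%N /\ c x y y = 0%N }.

Definition nondegenerate_cyclic (X : Type) (c : X -> X -> X -> nat) : Prop :=
  forall x y : X, x <> y -> c x y x <> 0%N.

Definition is_least d (T : preorderType d) (A : set T) (m : T) : Prop :=
  A m /\ forall y : T, A y -> (m <= y)%O.

(* Integer powers of f under composition; the partial inverse ['pinv_]
   is the actual inverse as soon as f is bijective. *)
Definition zpow (T : Type) (f : T -> T) (n : int) : T -> T :=
  match n with
  | Posz k => iter k f
  | Negz k => iter k.+1 ('pinv_(id) [set: T] f)
  end.

(* A preorderType is not assumed antisymmetric, and its strict order [x < y]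
   means that [x <= y] and not [y <= x]. The map [sigma] is an index of the
   predicate, but [covering_sigma] determines it from [proj], since a subset
   of a fiber has at most one least element. *)
Record covering_poset (X : Type) d (E : preorderType d)
    (proj : E -> X) (sigma : E -> E) : Prop := {
  covering_fiber : forall x : X, exists f : int -> E,
    set_bij [set: int] (proj @^-1` [set x]) f /\ {mono f : m n / m <= n >-> (m <= n)%O};
  covering_sigma : forall e : E,
    is_least [set e' : E | (proj @^-1` [set proj e]) e' /\ (e < e')%O] (sigma e);
  covering_sigma_bij : bijective sigma;
  covering_sigma_mono : {mono sigma : e e' / (e <= e')%O};
  covering_cofinal : forall e e' : E, exists m n : nat,
    (e <= iter m sigma e')%O /\ (iter m sigma e' <= iter (m + n)%N sigma e)%O }.

(* The covering poset determines [c]: replacing the section [lambda] by another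
   one changes [b] by a coboundary and leaves [c] unchanged. *)
Definition covering_poset_of (X : Type) (c : X -> X -> X -> nat)
    d (E : preorderType d) (proj : E -> X) (sigma : E -> E) : Prop :=
  covering_poset proj sigma /\
  exists (lambda : X -> E) (b : X -> X -> int),
    [/\ cancel lambda proj,
        forall x y : X,
          is_least [set n : int | (lambda x <= zpow sigma n (lambda y))%O] (b x y)
      & forall x y z : X, (c x y z)%:Z = b x y + b y z - b x z].

Record Zposet (T : Type) (le : rel T) (act : int -> T -> T) : Prop := {
  Zposet_refl : reflexive le;
  Zposet_anti : antisymmetric le;
  Zposet_trans : transitive le;
  Zposet_act0 : forall x : T, act 0 x = x;
  Zposet_actD : forall (m n : int) (x : T), act (m + n) x = act m (act n x);
  Zposet_homol : forall (x : T) (m n : int), m <= n -> le (act m x) (act n x);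
  Zposet_homor : forall (n : int) (x y : T), le x y -> le (act n x) (act n y) }.

(* A Z-subposet carries the induced relation and action, so that being closed
   under the action is the only requirement. *)
Definition Zsubposet (T : Type) (act : int -> T -> T) (A : set T) : Prop :=
  forall (n : int) (x : T), A x -> A (act n x).

Definition cyclic_Zsubposet (T : Type) (act : int -> T -> T) (A : set T) : Prop :=
  Zsubposet act A /\ exists2 a : T, A a & A = [set act n a | n in [set: int]].

(* Main.v *)
Require Import Defs.
From mathcomp Require Import all_boot all_order all_algebra.
From mathcomp Require Import boolp classical_sets functions.

(** Each fiber is a copy of [int] on which [sigma] is the shift [n |-> n + 1].
    Hence every point is [sigma^i (lambda x)] for some [x] and [i], the fibers
    are exactly the orbits of [sigma], and [<=] is antisymmetric on each of them.
    If equivalent points [sigma^i (lambda x)] and [sigma^j (lambda y)] lay over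
    distinct [x] and [y], then [b x y <= j - i] and [b y x <= i - j] while
    [b x x = 0], so [c x y x] would vanish, against nondegeneracy. *)

Local Open Scope classical_set_scope.

Section Covering.
Local Open Scope ring_scope.
Import Order.TTheory GRing.Theory Num.Theory.

Lemma bij_pinvK {T : Type} {f : T -> T} (dflt : T -> T) :
  bijective f -> cancel f ('pinv_dflt [set: T] f).
Proof.
move=> /bij_inj f_inj x; apply: pinvKV; last exact: in_setT.
by move=> y z _ _; apply: f_inj.
Qed.

Lemma zpow0 {T : Type} (f : T -> T) (x : T) : zpow f 0 x = x.
Proof. by []. Qed.

Lemma zpow_mono {d} {T : preorderType d} (f : T -> T) (n : int) :
  bijective f -> {mono f : x y / (x <= y)%O} ->
  {mono zpow f n : x y / (x <= y)%O}.
Proof.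
move=> f_bij f_mono; set g := 'pinv_(id) [set: T] f.
have gK : cancel g f by apply/(bij_can_sym f_bij)/bij_pinvK.
have g_mono : {mono g : x y / (x <= y)%O} by move=> x y; rewrite -f_mono !gK.
have iter_mono h k : {mono h : x y / (x <= y :> T)%O} ->
    {mono iter k h : x y / (x <= y)%O}.
  by move=> h_mono x y; elim: k => //= k; rewrite h_mono.
by case: n => k; apply: iter_mono.
Qed.

Section CoveringPoset.
Context {X : Type} {d : Order.disp_t} {E : preorderType d}.
Context {proj : E -> X} {sigma : E -> E}.
Hypothesis hE : covering_poset proj sigma.

(** This integer coordinate [f] on a fiber turns every question about a single orbit of [sigma] into
    arithmetic in [int]. *)
Lemma covering_fiber_shift (x : X) : exists f : int -> E,
  [/\ forall m, proj (f m) = x,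
      forall e, proj e = x -> exists m, e = f m,
      {mono f : m n / m <= n >-> (m <= n)%O}
    & forall n m, zpow sigma n (f m) = f (m + n)].
Proof.
have [f [[f_fun _ f_surj] f_mono]] := covering_fiber hE x.
have projf m : proj (f m) = x by exact: f_fun.
have fP e : proj e = x -> exists m, e = f m.
  by move=> /f_surj[m _ <-]; exists m.
have sigmaE m : sigma (f m) = f (m + 1).
  have [[/= sigma_fib lt_sigma] sigma_le] := covering_sigma hE (f m).
  have [k Dk] : exists k, sigma (f m) = f k by apply: fP; rewrite sigma_fib.
  (* [k <= m + 1] because [f (m + 1)] competes for the minimum defining [sigma (f m)]; [m + 1 <= k]
     because [sigma (f m)] is strictly above [f m] and the order is that of [int]. *)
  rewrite Dk; congr f; apply/eqP; rewrite eq_le -!f_mono -Dk.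
  apply/andP; split.
    apply: sigma_le; split=> /=; first by rewrite !projf.
    by rewrite (leW_mono f_mono) ltzD1.
  by rewrite Dk f_mono lezD1 -(leW_mono f_mono) -Dk.
exists f; split=> // -[] k m /=.
  by elim: k => [|k /= ->]; rewrite ?addr0 // sigmaE -addrA -PoszD addn1.
have sigma_pred n : 'pinv_(id) [set: E] sigma (f n) = f (n - 1).
  rewrite -[in LHS](subrK 1 n) -sigmaE bij_pinvK //.
  exact: covering_sigma_bij hE.
(* [Negz k] stands for [-(k + 1)], so the base case is already one application of the inverse. *)
elim: k => [|k /= ->]; rewrite sigma_pred //.
by rewrite -addrA !NegzE -opprD -PoszD addn1.
Qed.

(** In the fiber coordinate this is associativity of addition, which avoids a case split on the
    signs of [m] and [n]. *)
Lemma covering_zpowD (m n : int) (e : E) :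
  zpow sigma (m + n) e = zpow sigma m (zpow sigma n e).
Proof.
have [f [_ fP _ fS]] := covering_fiber_shift (proj e).
by have [k ->] := fP e erefl; rewrite !fS (addrC m) addrA.
Qed.

Lemma covering_zpow_le (e : E) (m n : int) :
  (zpow sigma m e <= zpow sigma n e)%O = (m <= n).
Proof.
have [f [_ fP f_mono fS]] := covering_fiber_shift (proj e).
by have [k ->] := fP e erefl; rewrite !fS f_mono lerD2l.
Qed.

Lemma covering_proj_zpow (n : int) (e : E) : proj (zpow sigma n e) = proj e.
Proof.
have [f [projf fP _ fS]] := covering_fiber_shift (proj e).
by have [k ->] := fP e erefl; rewrite fS !projf.
Qed.

Lemma covering_fiber_orbit (e e' : E) :
  proj e = proj e' -> exists n, e = zpow sigma n e'.
Proof.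
have [f [_ fP _ fS]] := covering_fiber_shift (proj e').
move=> /fP[m ->]; have [k ->] := fP e' erefl.
by exists (m - k); rewrite fS addrC subrK.
Qed.

Lemma covering_fiberE (e : E) :
  proj @^-1` [set proj e] = [set zpow sigma n e | n in [set: int]].
Proof.
apply/seteqP; split=> [e' /= /covering_fiber_orbit[n ->]|_ [n _ <-]] /=.
  by exists n.
exact: covering_proj_zpow.
Qed.

(** Cancelling the order automorphism [sigma^m] brings a comparison into the form that defines
    [b]. *)
Lemma covering_zpow_le2 (e e' : E) (m n : int) :
  (zpow sigma m e <= zpow sigma n e')%O = (e <= zpow sigma (n - m) e')%O.
Proof.
rewrite -{1}(subrK m n) (addrC _ m) [zpow _ (m + _) _]covering_zpowD zpow_mono //.
  exact: covering_sigma_bij hE.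
exact: covering_sigma_mono hE.
Qed.

End CoveringPoset.

Lemma covering_le_anti {X : Type} {c : X -> X -> X -> nat} {d : Order.disp_t}
    {E : preorderType d} {proj : E -> X} {sigma : E -> E} :
  nondegenerate_cyclic c -> covering_poset_of c proj sigma ->
  antisymmetric (fun e e' : E => (e <= e')%O).
Proof.
move=> c_nd [hE [lambda [b [lambdaK bP cE]]]] e e' /andP[].
have [i ->] : exists i, e = zpow sigma i (lambda (proj e)).
  by apply: (covering_fiber_orbit hE); rewrite lambdaK.
have [j ->] : exists j, e' = zpow sigma j (lambda (proj e')).
  by apply: (covering_fiber_orbit hE); rewrite lambdaK.
move: (proj e) (proj e') => x y; rewrite !(covering_zpow_le2 hE) => le_xy le_yx.
have bxy : b x y <= j - i by apply: (bP x y).2.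
have byx : b y x <= i - j by apply: (bP y x).2.
(* Since [lambda x] is its own power of exponent 0, any exponent admissible for [b x x] is
   nonnegative. *)
have bxx : 0 <= b x x.
  by have := (bP x x).1; rewrite /= -{1}[lambda x](zpow0 sigma) (covering_zpow_le hE).
have cxyx : c x y x = 0%N.
  apply/eqP; rewrite -leqn0 -lez_nat cE subr_le0 (le_trans _ bxx) //.
  by rewrite (le_trans (lerD bxy byx)) // addrA subrK subrr.
have Dxy : x = y by apply: contrapT => /c_nd.
(* Both points now lie on one orbit, where the order is that of the exponents. *)
move: le_xy le_yx; rewrite Dxy -!(covering_zpow_le2 hE) !(covering_zpow_le hE) => ij ji.
by congr (zpow sigma _ _); apply/le_anti; rewrite ij ji.
Qed.

End Covering.

Theorem theorem2p12 (X : Type) (c : X -> X -> X -> nat)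
    (hc : cyclic_poset c) (hnd : nondegenerate_cyclic c)
    (d : Order.disp_t) (E : preorderType d) (proj : E -> X) (sigma : E -> E)
    (hE : covering_poset_of c proj sigma) :
  Zposet (fun e e' : E => (e <= e')%O) (zpow sigma) /\
  set_bij [set: X] [set A : set E | cyclic_Zsubposet (zpow sigma) A]
    (fun x : X => proj @^-1` [set x]).
Proof.
have [hC [lambda [b [lambdaK _ _]]]] := hE.
split.
  split.
  - exact: Order.PreorderTheory.lexx.
  - exact: covering_le_anti hnd hE.
  - exact: Order.PreorderTheory.le_trans.
  - exact: zpow0.
  - exact: covering_zpowD hC.
  - by move=> e m n; rewrite (covering_zpow_le hC).
  - move=> n x y; rewrite zpow_mono //.
      exact: covering_sigma_bij hC.
    exact: covering_sigma_mono hC.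
split.
- move=> x _; split=> [n e /= <-|]; first exact: covering_proj_zpow.
  exists (lambda x); first exact: lambdaK.
  by rewrite -(covering_fiberE hC) lambdaK.
(* Injectivity: fibers are nonempty, and the point [lambda x] of a common fiber projects to both [x]
   and [y]. *)
- move=> x y _ _ /seteqP[/(_ (lambda x) (lambdaK x)) /= <- _].
  by rewrite lambdaK.
- move=> A [_ [a _ ->]]; exists (proj a) => //.
  exact: covering_fiberE.
Qed.
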